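(* Let $\mathbf{z}\in K_{\exp}^*$ be such that $\{\mathbf{z}\}^\perp\cap K_{\exp}=\mathcal{F}_{-\infty}$ is the two-dimensional face of $K_{\exp}$. Let $\mathfrak{g}=\mathfrak{g}_{-\infty}$ or $\mathfrak{g}=|\cdot|^\alpha$ for some $\alpha\in(0,1)$. For $t\ge0$ let $\kappa_{\mathbf{z},t}:=\max\{2,2\gamma_{\mathbf{z},t}^{-1}\}$ if $\mathfrak{g}=\mathfrak{g}_{-\infty}$, and $\kappa_{\mathbf{z},t}:=\max\{2t^{1-\alpha},2\gamma_{\mathbf{z},t}^{-1}\}$ if $\mathfrak{g}=|\cdot|^\alpha$, where $\gamma_{\mathbf{z},t}$ is defined with the chosen $\mathfrak{g}$. Then the function $\psi_{\mathcal{K},\mathbf{z}}:\mathbb{R}_+\times\mathbb{R}_+\to\mathbb{R}_+$ given by $$\psi_{\mathcal{K},\mathbf{z}}(\epsilon,t):=\max\{\epsilon,\epsilon/\|\mathbf{z}\|\}+\kappa_{\mathbf{z},t}\,\mathfrak{g}(\epsilon+\max\{\epsilon,\epsilon/\|\mathbf{z}\|\})$$ is a one-step facial residual function for $K_{\exp}$ and $\mathbf{z}$. In particular, there exist $\kappa>0$ and a nonnegative monotone nondecreasing function $\rho:\mathbb{R}_+\to\mathbb{R}_+$ such that the function $\hat\psi_{\mathcal{K},\mathbf{z}}(\epsilon,t):=\kappa\epsilon+\rho(t)\mathfrak{g}(\epsilon)$ is a one-step facial residual function for $K_{\exp}$ and $\mathbf{z}$.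
   Context: $\mathbb{R}^3$ carries the standard inner product and Euclidean norm; $\mathbb{R}_+=[0,\infty)$. $K_{\exp}=\{(x,y,z):y>0,\ z\ge ye^{x/y}\}\cup\{(x,y,z):x\le0,\ z\ge0,\ y=0\}$ is the exponential cone, $K_{\exp}^*$ its dual cone, $\partial K_{\exp}$ its boundary, and $\mathcal{F}_{-\infty}=\{(x,y,z):x\le0,\ z\ge0,\ y=0\}$. $\mathfrak{g}_{-\infty}:\mathbb{R}_+\to\mathbb{R}_+$ is defined by $\mathfrak{g}_{-\infty}(0)=0$, $\mathfrak{g}_{-\infty}(t)=-t\ln t$ for $0<t\le1/e^2$, $\mathfrak{g}_{-\infty}(t)=t+1/e^2$ for $t>1/e^2$. For $\eta\ge0$ and $\mathfrak{g}:\mathbb{R}_+\to\mathbb{R}_+$, $$\gamma_{\mathbf{z},\eta}:=\inf_{\mathbf{v}}\left\{\frac{\mathfrak{g}(\|\mathbf{w}-\mathbf{v}\|)}{\|\mathbf{w}-\mathbf{u}\|}\;\Big|\;\mathbf{v}\in\partial K_{\exp}\cap B(\eta)\setminus\mathcal{F}_{-\infty},\ \mathbf{w}=P_{\{\mathbf{z}\}^\perp}\mathbf{v},\ \mathbf{u}=P_{\mathcal{F}_{-\infty}}\mathbf{w},\ \mathbf{w}\ne\mathbf{u}\right\},$$ where $B(\eta)$ is the closed ball of radius $\eta$ centered at the origin and $P_C$ is the orthogonal projection onto $C$; the infimum over the empty set is $+\infty$ and $1/\infty=0$. One-step facial residual function for a closed convex cone $\mathcal{K}$ and $\mathbf{z}\in\mathcal{K}^*$: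 a function $\psi:\mathbb{R}_+\times\mathbb{R}_+\to\mathbb{R}_+$ that is monotone nondecreasing in each argument, satisfies $\psi(0,t)=0$ for all $t$, and is such that for every $\mathbf{x}\in\mathrm{span}\,\mathcal{K}$ and $\epsilon\ge0$, $\mathrm{d}(\mathbf{x},\mathcal{K})\le\epsilon$ and $\langle\mathbf{x},\mathbf{z}\rangle\le\epsilon$ imply $\mathrm{d}(\mathbf{x},\mathcal{K}\cap\{\mathbf{z}\}^\perp)\le\psi(\epsilon,\|\mathbf{x}\|)$, where $\mathrm{d}(\cdot,C)$ is the distance to $C$. *)

(* Defs.v *)
From HB Require Import structures.
From mathcomp Require Import all_boot all_order all_algebra.
From mathcomp Require Import all_classical all_reals all_analysis.
Import Order.TTheory GRing.Theory Num.Theory numFieldNormedType.Exports.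

Set Implicit Arguments.
Unset Strict Implicit.
Unset Printing Implicit Defensive.

Local Open Scope classical_set_scope.
Local Open Scope ring_scope.

Section Euclidean.
Context {R : realType} {n : nat}.
Implicit Types (x y z p : 'rV[R]_n) (C K : set 'rV[R]_n).

Definition dotv x y : R := \sum_(i < n) x 0 i * y 0 i.

(* The library norm [`|x|] on ['rV[R]_n] is the sup norm, hence this one. *)
Definition enorm x : R := Num.sqrt (dotv x x).

(* Only meaningful for nonempty [C]; by convention [inf set0 = 0]. *)
Definition edist x C : R := inf [set enorm (x - y) | y in C].

(* [is_proj C x p] says p = P_C x: for [C] nonempty, closed and convex there is
   exactly one such [p]. *)
Definition is_proj C x p : Prop :=
  C p /\ forall q, C q -> enorm (x - p) <= enorm (x - q).

Definition eball (eta : R) : set 'rV[R]_n := [set x | enorm x <= eta].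

(* The product topology of ['rV[R]_n] is the Euclidean one. *)
Definition boundary C : set 'rV[R]_n := closure C `\` interior C.

Definition perp z : set 'rV[R]_n := [set x | dotv x z = 0].

Definition dual_cone K : set 'rV[R]_n :=
  [set z | forall x, K x -> 0 <= dotv x z].

Definition lspan C : set 'rV[R]_n :=
  [set x | exists2 s : seq 'rV[R]_n,
    (forall y, y \in s -> C y) & x \in << s >>%VS].

(* Functions on R_+ are represented by functions on [R] of which only the
   values at nonnegative arguments are constrained. *)
Definition one_step_frf K z (psi : R -> R -> R) : Prop :=
  [/\ forall eps t, 0 <= eps -> 0 <= t -> 0 <= psi eps t,
      forall eps eps' t, 0 <= eps -> eps <= eps' -> 0 <= t ->
        psi eps t <= psi eps' t,
      forall eps t t', 0 <= eps -> 0 <= t -> t <= t' ->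
        psi eps t <= psi eps t',
      forall t, 0 <= t -> psi 0 t = 0
    & forall x eps, lspan K x -> 0 <= eps ->
        edist x K <= eps -> dotv x z <= eps ->
        edist x (K `&` perp z) <= psi eps (enorm x)].

End Euclidean.

Section ExponentialCone.
Context {R : realType}.

(* The coordinates (x, y, z) of [v] are [v 0 0], [v 0 1] and [v 0 2]. *)
Definition F_minf : set 'rV[R]_3 :=
  [set v : 'rV[R]_3 | [/\ v 0 0 <= 0, 0 <= v 0 2 & v 0 1 = 0]].

Definition Kexp : set 'rV[R]_3 :=
  [set v : 'rV[R]_3 | 0 < v 0 1 /\ v 0 1 * expR (v 0 0 / v 0 1) <= v 0 2] `|` F_minf.

Definition g_minf (t : R) : R :=
  if t <= 0 then 0
  else if t <= (expR 1 ^+ 2)^-1 then - t * ln t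
  else t + (expR 1 ^+ 2)^-1.

(* Valued in the extended reals: [ereal_inf set0 = +oo]. *)
Definition gamma (g : R -> R) (z : 'rV[R]_3) (eta : R) : \bar R :=
  ereal_inf [set r | exists v w u : 'rV[R]_3,
    [/\ ((boundary Kexp `&` eball eta) `\` F_minf) v,
        is_proj (perp z) v w, is_proj F_minf w u, w <> u
      & r = (g (enorm (w - v)) / enorm (w - u))%:E]].

Definition psi_exp (g kappa : R -> R) (z : 'rV[R]_3) (eps t : R) : R :=
  let m := Num.max eps (eps / enorm z) in
  m + kappa t * g (eps + m).

End ExponentialCone.

(* Main.v *)
(* The normal is z = (0, b, 0) with b > 0, so {z}^perp is the plane y = 0. For v on the
   boundary with x, y > 0 one has |w - v| = y and |w - u| = x, so the ratio in
   gamma is g(y) / x under the constraint y e^(x/y) <= eta. Since then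
   x <= y ln (eta / y), which is at most a multiple of g(y), gamma > 0.
   A point with residual eps is within m = max(eps, eps / b) of its projection q
   to the plane, q is within eps + m of the cone, and gamma bounds the distance from
   q to the face. The second residual function follows from g (L t) <= C g t,
   which absorbs eps + m <= L eps. *)

Require Import Defs.
From HB Require Import structures.
From mathcomp Require Import all_boot all_order all_algebra.
From mathcomp Require Import all_classical all_reals all_analysis.
From mathcomp Require Import ring lra.
Import Order.TTheory GRing.Theory Num.Theory numFieldNormedType.Exports.

Local Open Scope classical_set_scope.
Local Open Scope ring_scope.

Set Implicit Arguments.
Unset Strict Implicit.
Unset Printing Implicit Defensive.

(** * Inner product and Euclidean norm *)

Lemma dotvC (R : realType) n (x y : 'rV[R]_n) : dotv x y = dotv y x.
Proof. by apply: eq_bigr => i _; rewrite mulrC. Qed.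

Lemma dotvDl (R : realType) n (x x' y : 'rV[R]_n) :
  dotv (x + x') y = dotv x y + dotv x' y.
Proof. by rewrite -big_split; apply: eq_bigr => i _; rewrite mxE mulrDl. Qed.

Lemma dotvZl (R : realType) n a (x y : 'rV[R]_n) : dotv (a *: x) y = a * dotv x y.
Proof. by rewrite mulr_sumr; apply: eq_bigr => i _; rewrite mxE mulrA. Qed.

Lemma dotv_ge0 (R : realType) n (x : 'rV[R]_n) : 0 <= dotv x x.
Proof. by apply: sumr_ge0 => i _; rewrite -expr2 sqr_ge0. Qed.

Lemma dotv_addZ (R : realType) n a (x y : 'rV[R]_n) :
  dotv (x + a *: y) (x + a *: y) =
  dotv x x + a * dotv x y *+ 2 + a ^+ 2 * dotv y y.
Proof.
rewrite dotvDl dotvZl !(dotvC _ (x + _)) !dotvDl !dotvZl (dotvC y x); ring.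
Qed.

Lemma dotv_sub (R : realType) n (x y : 'rV[R]_n) :
  dotv (x - y) (x - y) = dotv x x - dotv x y *+ 2 + dotv y y.
Proof. by rewrite -scaleN1r dotv_addZ; ring. Qed.

Lemma dotv_eq0 (R : realType) n (x y : 'rV[R]_n) : dotv x x = 0 -> dotv x y = 0.
Proof.
move=> /eqP; rewrite psumr_eq0 => [/allP x0|i _]; last by rewrite -expr2 sqr_ge0.
apply: big1 => i _; have /= := x0 i (mem_index_enum i).
by rewrite mulf_eq0 orbb => /eqP ->; rewrite mul0r.
Qed.

Lemma dotv_CauchySchwarz (R : realType) n (x y : 'rV[R]_n) :
  dotv x y ^+ 2 <= dotv x x * dotv y y.
Proof.
have [y0|yn0] := eqVneq (dotv y y) 0.
  by rewrite dotvC dotv_eq0// y0 expr0n mulr0.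
have y_gt0 : 0 < dotv y y by rewrite lt_def yn0 dotv_ge0.
(* Removing from [x] its component along [y] leaves a vector of squared norm
   [(a * b - c ^+ 2) / b]. *)
have := dotv_ge0 (x + (- (dotv x y / dotv y y)) *: y).
rewrite dotv_addZ; set a := dotv x x; set b := dotv y y in yn0 y_gt0 *.
set c := dotv x y.
have -> : a + - (c / b) * c *+ 2 + (- (c / b)) ^+ 2 * b = (a * b - c ^+ 2) / b.
  by field.
by rewrite pmulr_lge0 ?invr_gt0// subr_ge0.
Qed.

Lemma enorm_ge0 (R : realType) n (x : 'rV[R]_n) : 0 <= enorm x.
Proof. exact: sqrtr_ge0. Qed.

Lemma enorm_sqr (R : realType) n (x : 'rV[R]_n) : enorm x ^+ 2 = dotv x x.
Proof. exact/sqr_sqrtr/dotv_ge0. Qed.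

Lemma enormN (R : realType) n (x : 'rV[R]_n) : enorm (- x) = enorm x.
Proof.
by rewrite /enorm /dotv; congr Num.sqrt; apply: eq_bigr => i _; rewrite !mxE mulrNN.
Qed.

Lemma enormB (R : realType) n (x y : 'rV[R]_n) : enorm (x - y) = enorm (y - x).
Proof. by rewrite -enormN opprB. Qed.

Lemma enorm_triangle (R : realType) n (x y : 'rV[R]_n) :
  enorm (x + y) <= enorm x + enorm y.
Proof.
rewrite -ler_sqr ?nnegrE ?addr_ge0 ?enorm_ge0// enorm_sqr sqrrD !enorm_sqr.
have := dotv_addZ 1 x y; rewrite scale1r => ->; rewrite expr1n !mul1r lerD2r lerD2l lerMn2r /=.
apply: le_trans (ler_norm _) _.
rewrite -ler_sqr ?nnegrE ?mulr_ge0 ?enorm_ge0// exprMn !enorm_sqr.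
by rewrite real_normK ?num_real// dotv_CauchySchwarz.
Qed.

Lemma enorm_distD (R : realType) n (y x z : 'rV[R]_n) :
  enorm (x - z) <= enorm (x - y) + enorm (y - z).
Proof. by rewrite -{1}(subrK y x) -addrA enorm_triangle. Qed.

Lemma norm_coord_le (R : realType) n (x : 'rV[R]_n) i : `|x 0 i| <= enorm x.
Proof.
rewrite -sqrtr_sqr; apply: ler_wsqrtr.
rewrite /dotv (bigD1 i)//= -expr2 lerDl.
by apply: sumr_ge0 => j _; rewrite -expr2 sqr_ge0.
Qed.

(** Links the Euclidean norm to the sup norm, in which boundedness and the balls of the topology are
    expressed. *)
Lemma mx_norm_le_enorm (R : realType) n (x : 'rV[R]_n) : `|x| <= enorm x.
Proof.
have -> : `|x| = mx_norm x by [].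
rewrite mx_normE.
apply: (big_ind (fun t : {nonneg R} => t%:num <= enorm x)) => /=.
- exact: enorm_ge0.
- by move=> a b ha hb; rewrite /Order.max; case: ifP.
- by move=> [i j] _ /=; rewrite ord1 norm_coord_le.
Qed.

(** * Nearest points and distances *)

Lemma continuous_sum (R : realType) (T : topologicalType) I (s : seq I)
    (F : I -> T -> R) :
  (forall i, continuous (F i)) -> continuous (fun x => \sum_(i <- s) F i x).
Proof.
move=> Fc; elim: s => [|i s IHs].
  rewrite (_ : (fun _ => _) = cst 0); first exact: cst_continuous.
  by apply/funext => y; rewrite big_nil.
rewrite (_ : (fun _ => _) = F i \+ (fun x => \sum_(i <- s) F i x)).
  by move=> x; apply: cvgD; [exact: Fc|exact: IHs].
by apply/funext => y; rewrite big_cons.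
Qed.

Lemma continuous_mul (R : realType) (T : topologicalType) (f g : T -> R) :
  continuous f -> continuous g -> continuous (fun x => f x * g x).
Proof. by move=> fc gc x; apply: cvgM; [exact: fc|exact: gc]. Qed.

Lemma enorm_dist_continuous (R : realType) n (x : 'rV[R]_n) :
  continuous (fun y : 'rV[R]_n => enorm (x - y)).
Proof.
rewrite /enorm => y; apply: continuous_comp; last exact: sqrt_continuous.
apply: continuous_sum => i.
suff c : continuous (fun y : 'rV[R]_n => (x - y) 0 i) by exact: continuous_mul.
rewrite (_ : (fun _ => _) = (fun t => x 0 i - t) \o (fun y : 'rV[R]_n => y 0 i)).
  move=> {}y; apply: continuous_comp; first exact: coord_continuous.
  by apply: cvgB; [exact: cvg_cst|exact: cvg_id].
by apply/funext => {}y; rewrite /= !mxE.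
Qed.

(** The points of [C] no farther from [x] than a fixed [c0] form a compact set, on which the
    continuous distance to [x] attains its minimum. *)
Lemma ex_proj (R : realType) n (C : set 'rV[R]_n) (x : 'rV[R]_n) :
  closed C -> C !=set0 -> exists p, is_proj C x p.
Proof.
move=> cC [c0 Cc0].
have cts := @enorm_dist_continuous R n x.
pose S := C `&` [set y | enorm (x - y) <= enorm (x - c0)].
have clS : closed S.
  apply: closedI => //.
  by have /continuous_closedP/(_ _ (@closed_le _ (enorm (x - c0)))) := cts.
have bS : bounded_set S.
  exists (enorm x + enorm (x - c0)); split; first exact: num_real.
  move=> M ltM y [_ /= yle]; apply: le_trans (ltW ltM).
  apply: le_trans (mx_norm_le_enorm _) _.
  rewrite -(subrK x y) (le_trans (enorm_triangle _ _))//.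
  by rewrite [leLHS]addrC lerD2l (enormB y).
have S0 : S !=set0 by exists c0; split=> /=.
have ctsS : {within S, continuous (fun y => enorm (x - y))}.
  by apply: continuous_subspaceT => y; exact: cts.
have [p] := compact_EVT_min S0 (bounded_closed_compact bS clS) ctsS.
rewrite inE => -[Cp ple] pmin; exists p; split=> // q Cq.
have [qle|/ltW qgt] := leP (enorm (x - q)) (enorm (x - c0)).
  by apply: pmin; rewrite inE; split.
exact: le_trans ple qgt.
Qed.

Lemma edist_le (R : realType) n (C : set 'rV[R]_n) x y :
  C y -> Defs.edist x C <= enorm (x - y).
Proof.
move=> Cy; apply: ge_inf; last by exists y.
by exists 0 => _ [c _ <-]; exact: enorm_ge0.
Qed.

Lemma edist_proj (R : realType) n (C : set 'rV[R]_n) x p :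
  is_proj C x p -> Defs.edist x C = enorm (x - p).
Proof.
move=> [Cp pmin]; apply/eqP; rewrite eq_le edist_le//=.
by apply: lb_le_inf; [exists (enorm (x - p)), p | move=> _ [c Cc <-]; exact: pmin].
Qed.

(** Comparing [p] with its shrunken copies [(1 - s) *: p] yields [0 <= dotv (x - p) p]; adding twice
    this to [0 <= dotv (x - p) (x - p)] gives the bound. It keeps the projection inside the ball
    over which [gamma] is taken. *)
Lemma enorm_cone_proj (R : realType) n (K : set 'rV[R]_n) x p :
  (forall a y, 0 <= a -> K y -> K (a *: y)) -> is_proj K x p -> enorm p <= enorm x.
Proof.
move=> coneK [Kp pmin].
have scaled s : 0 < s -> s <= 1 -> 0 <= dotv (x - p) p *+ 2 + s * dotv p p.
  move=> s0 s1; have := pmin ((1 - s) *: p) (coneK _ _ _ Kp); rewrite subr_ge0 => /(_ s1).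
  have -> : x - (1 - s) *: p = (x - p) + s *: p.
    by rewrite scalerBl scale1r opprB addrCA addrC.
  rewrite -ler_sqr ?nnegrE ?enorm_ge0// !enorm_sqr dotv_addZ -addrA lerDl.
  by rewrite -mulrnAr expr2 -mulrA -mulrDr pmulr_rge0.
have xpp : 0 <= dotv (x - p) p *+ 2.
  rewrite leNgt; apply/negP => neg.
  have den : 0 < dotv p p + 1 by rewrite ltr_wpDl ?dotv_ge0.
  (* So small that the term [s * dotv p p] makes up at most half of the negative first-order term;
     the [+ 1] keeps the denominator positive. *)
  pose s := Num.min 1 (- (dotv (x - p) p *+ 2) / 2 / (dotv p p + 1)).
  have s0 : 0 < s by rewrite /s lt_min ltr01 /= !divr_gt0// oppr_gt0.
  have s1 : s <= 1 by rewrite /s ge_min lexx.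
  have sle : s * (dotv p p + 1) <= - (dotv (x - p) p *+ 2) / 2.
    by rewrite -ler_pdivlMr// /s ge_min lexx orbT.
  have := scaled _ s0 s1; lra.
rewrite -ler_sqr ?nnegrE ?enorm_ge0// !enorm_sqr.
have := dotv_ge0 (x - p); rewrite dotv_sub.
move: xpp; rewrite -[- p]scaleN1r dotvDl dotvZl; lra.
Qed.

Lemma enormZ (R : realType) n a (x : 'rV[R]_n) : enorm (a *: x) = `|a| * enorm x.
Proof.
rewrite /enorm dotvZl dotvC dotvZl mulrA -expr2 sqrtrM ?sqr_ge0//.
by rewrite sqrtr_sqr.
Qed.

(** From an interior point of [C] a short move towards [x] would stay in [C] and come strictly
    closer to [x]. *)
Lemma proj_boundary (R : realType) n (C : set 'rV[R]_n) x p :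
  is_proj C x p -> ~ C x -> boundary C p.
Proof.
move=> [Cp pmin] nCx; split; first exact: subset_closure.
rewrite /interior /= => /nbhs_ballP[e /= e0 eC].
have d0 : 0 < enorm (x - p).
  rewrite lt_def enorm_ge0 andbT; apply/eqP => d0; apply: nCx.
  suff -> : x = p by [].
  apply/eqP; rewrite -subr_eq0 -normr_le0.
  by apply: le_trans (mx_norm_le_enorm _) _; rewrite d0.
pose s := Num.min 1 (e / 2 / enorm (x - p)).
have s0 : 0 < s by rewrite lt_min ltr01 !divr_gt0.
have s1 : s <= 1 by rewrite ge_min lexx.
have sle : s * enorm (x - p) <= e / 2 by rewrite -ler_pdivlMr// ge_min lexx orbT.
have /pmin : C (p + s *: (x - p)).
  apply: eC; rewrite -ball_normE /= opprD addrA subrr add0r normrN.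
  apply: le_lt_trans (mx_norm_le_enorm _) _.
  rewrite enormZ gtr0_norm//; lra.
have -> : x - (p + s *: (x - p)) = (1 - s) *: (x - p).
  by rewrite scalerBl scale1r opprD addrA.
rewrite enormZ ger0_norm ?subr_ge0// leNgt mulrBl mul1r => /negP; apply.
by rewrite ltrBlDr ltrDl mulr_gt0.
Qed.

Lemma closed_dual_cone (R : realType) n (K : set 'rV[R]_n) : closed (dual_cone K).
Proof.
rewrite (_ : dual_cone K = \bigcap_(x in K) [set z | 0 <= dotv x z]).
  apply: closed_bigI => x _.
  have dc : continuous (fun z : 'rV[R]_n => dotv x z).
    apply: continuous_sum => i; apply: continuous_mul.
      by move=> z; exact: cst_continuous.
    exact: coord_continuous.
  by have /continuous_closedP/(_ _ (@closed_ge _ 0)) := dc.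
by apply/seteqP; split.
Qed.

(** * Coordinates in dimension three and the exponential cone *)

Lemma dotv3 (R : realType) (x y : 'rV[R]_3) :
  dotv x y = x 0 0 * y 0 0 + x 0 1 * y 0 1 + x 0 2 * y 0 2.
Proof.
rewrite /dotv !big_ord_recl big_ord0 addr0 addrA.
have -> : lift ord0 ord0 = 1 :> 'I_3 by exact/val_inj.
by have -> : lift ord0 (lift ord0 ord0) = 2 :> 'I_3 by exact/val_inj.
Qed.

Definition vec3 {R : realType} (a b c : R) : 'rV[R]_3 := \row_i [:: a; b; c]`_i.

Lemma vec3_0 (R : realType) (a b c : R) : vec3 a b c 0 0 = a.
Proof. by rewrite mxE. Qed.

Lemma vec3_1 (R : realType) (a b c : R) : vec3 a b c 0 1 = b.
Proof. by rewrite mxE. Qed.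

Lemma vec3_2 (R : realType) (a b c : R) : vec3 a b c 0 2 = c.
Proof. by rewrite mxE. Qed.

Definition vec3E := (vec3_0, vec3_1, vec3_2).

Lemma vec3_ext (R : realType) (x y : 'rV[R]_3) :
  x 0 0 = y 0 0 -> x 0 1 = y 0 1 -> x 0 2 = y 0 2 -> x = y.
Proof.
move=> e0 e1 e2; apply/rowP => -[[|[|[|//]]] i].
- by have -> : Ordinal i = 0 by exact/val_inj.
- by have -> : Ordinal i = 1 by exact/val_inj.
- by have -> : Ordinal i = 2 by exact/val_inj.
Qed.

Lemma enorm3_sqr (R : realType) (x : 'rV[R]_3) :
  enorm x ^+ 2 = x 0 0 ^+ 2 + x 0 1 ^+ 2 + x 0 2 ^+ 2.
Proof. by rewrite enorm_sqr dotv3 !expr2. Qed.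

(* [y * expR (x / y)] is the supremum of its tangent planes
   [expR s * (x + (1 - s) * y)]. *)
Definition Kexp_normals {R : realType} : set 'rV[R]_3 :=
  [set vec3 0 1 0; vec3 0 0 1] `|`
  [set vec3 (- expR s) (- (expR s * (1 - s))) 1 | s in setT].

(** Presents the cone as an intersection of closed half-spaces, from which closedness and stability
    under nonnegative scaling follow. *)
Lemma KexpE (R : realType) : Kexp = dual_cone (@Kexp_normals R).
Proof.
apply/seteqP; split=> v.
  have tangent s : Kexp v -> expR s * v 0 0 + expR s * (1 - s) * v 0 1 <= v 0 2.
    case=> [[v1 /(le_trans _)]|[v0 v2 ->]]; last first.
      by rewrite mulr0 addr0 (le_trans _ v2)// mulr_ge0_le0// expR_ge0.
    apply; set r := v 0 0 / v 0 1.
    have -> : v 0 0 = r * v 0 1 by rewrite divfK// gt_eqF.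
    have -> : expR r = expR s * expR (r - s) by rewrite -expRD addrC subrK.
    (* The bound [1 + (r - s) <= expR (r - s)], multiplied by [expR s * v 0 1], is the tangent
       inequality. *)
    have := ler_pM2l (mulr_gt0 (expR_gt0 s) v1) (1 + (r - s)) (expR (r - s)).
    rewrite expR_ge1Dx; lra.
  move=> Kv w; case=> [[->|->]|[s _ <-]]; rewrite dotv3 !vec3E.
  - case: Kv => [[v1 _]|[_ _ ->]]; lra.
  - case: Kv => [[v1 /(le_trans _)h]|[_ h _]]; last by lra.
    have : 0 <= v 0 1 * expR (v 0 0 / v 0 1) by rewrite mulr_ge0 ?expR_ge0// ltW.
    by move/h; lra.
  - have := tangent s Kv; lra.
move=> Kv.
have v1 : 0 <= v 0 1.
  by have := Kv (vec3 0 1 0) (or_introl (or_introl erefl)); rewrite dotv3 !vec3E; lra.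
have v2 : 0 <= v 0 2.
  by have := Kv (vec3 0 0 1) (or_introl (or_intror erefl)); rewrite dotv3 !vec3E; lra.
have tangent s : expR s * v 0 0 + expR s * (1 - s) * v 0 1 <= v 0 2.
  have : Kexp_normals (vec3 (- expR s) (- (expR s * (1 - s))) 1) by right; exists s.
  by move=> /Kv; rewrite dotv3 !vec3E; lra.
have [v10|v10] := eqVneq (v 0 1) 0.
  right; split=> //; rewrite leNgt; apply/negP => v0.
  (* With this slope [s], [expR s * v 0 0 >= (1 + s) * v 0 0 = v 0 0 + v 0 2], which exceeds
     [v 0 2]. *)
  have := tangent (v 0 2 / v 0 0); rewrite v10 mulr0 addr0.
  apply/negP; rewrite -ltNge.
  apply: (@lt_le_trans _ _ ((1 + v 0 2 / v 0 0) * v 0 0)).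
    by rewrite mulrDl mul1r divfK ?gt_eqF// ltrDr.
  by rewrite ler_pM2r// expR_ge1Dx.
left; have v1_gt0 : 0 < v 0 1 by rewrite lt_def v10.
(* The tangent plane at the slope of [v] itself is tight. *)
split=> //; have := tangent (v 0 0 / v 0 1); set r := _ / _.
have -> : v 0 0 = r * v 0 1 by rewrite divfK// gt_eqF.
lra.
Qed.

Lemma Kexp_ge0 (R : realType) (v : 'rV[R]_3) : Kexp v -> 0 <= v 0 1 /\ 0 <= v 0 2.
Proof.
case=> [[v1 v2]|[_ v2 ->]]//; split; first exact: ltW.
by apply: le_trans v2; rewrite mulr_ge0 ?expR_ge0// ltW.
Qed.

Lemma Kexp_scale (R : realType) a (v : 'rV[R]_3) : 0 <= a -> Kexp v -> Kexp (a *: v).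
Proof.
rewrite KexpE => a0 Kv w /Kv; rewrite (dotvC w (_ *: _)) dotvZl (dotvC v); exact: mulr_ge0.
Qed.

Lemma closed_Kexp (R : realType) : closed (@Kexp R).
Proof. by rewrite KexpE; exact: closed_dual_cone. Qed.

Lemma rV_subE (R : realType) n (x y : 'rV[R]_n) i : (x - y) 0 i = x 0 i - y 0 i.
Proof. by rewrite !mxE. Qed.

Lemma le_enorm3 (R : realType) (x y : 'rV[R]_3) :
  x 0 0 ^+ 2 + x 0 1 ^+ 2 + x 0 2 ^+ 2 <= y 0 0 ^+ 2 + y 0 1 ^+ 2 + y 0 2 ^+ 2 ->
  enorm x <= enorm y.
Proof. by rewrite -!enorm3_sqr ler_sqr ?nnegrE ?enorm_ge0. Qed.

Lemma enorm_vec3_0 (R : realType) (a : R) : enorm (vec3 a 0 0) = `|a|.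
Proof. by rewrite -sqrtr_sqr /enorm dotv3 !vec3E; congr Num.sqrt; ring. Qed.

Lemma enorm_vec3_1 (R : realType) (a : R) : enorm (vec3 0 a 0) = `|a|.
Proof. by rewrite -sqrtr_sqr /enorm dotv3 !vec3E; congr Num.sqrt; ring. Qed.

Lemma enorm0 (R : realType) n : enorm (0 : 'rV[R]_n) = 0.
Proof. by rewrite -(scale0r 0) enormZ normr0 mul0r. Qed.

Lemma enorm_le0 (R : realType) n (x : 'rV[R]_n) : enorm x <= 0 -> x = 0.
Proof.
move=> x0; apply/eqP; rewrite -normr_le0; exact: le_trans (mx_norm_le_enorm _) x0.
Qed.

Lemma edist_triangle (R : realType) n (C : set 'rV[R]_n) x y :
  C !=set0 -> Defs.edist x C <= enorm (x - y) + Defs.edist y C.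
Proof.
move=> [c0 Cc0]; rewrite -lerBlDl; apply: lb_le_inf; first by exists (enorm (y - c0)), c0.
move=> _ [c Cc <-]; rewrite lerBlDl.
exact: le_trans (edist_le _ Cc) (enorm_distD _ _ _).
Qed.

Lemma edist_set_ge0 (R : realType) n (C : set 'rV[R]_n) x :
  C !=set0 -> 0 <= Defs.edist x C.
Proof.
by move=> [c Cc]; apply: lb_le_inf; [exists (enorm (x - c)), c
                                   |move=> _ [? _ <-]; exact: enorm_ge0].
Qed.

(** * The two-dimensional face, its normal and [gamma] *)

Lemma F_minf0 (R : realType) : @F_minf R 0.
Proof. by rewrite /F_minf /= !mxE. Qed.

Lemma Kexp_plane (R : realType) (v : 'rV[R]_3) : Kexp v -> v 0 1 = 0 -> F_minf v.
Proof. by case=> [[+ _] v1|//]; rewrite v1 ltxx. Qed.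

(** Orthogonality to the face vectors (-1, 0, 0) and (0, 0, 1) kills two coordinates. The cone point
    (0, 1, 1) lies off the face, so its product with [z], the middle coordinate, is positive. *)
Lemma face_normal (R : realType) (z : 'rV[R]_3) :
  dual_cone Kexp z -> perp z `&` Kexp = F_minf ->
  exists2 b : R, 0 < b & z = vec3 0 b 0.
Proof.
move=> zd zf.
have FP v : F_minf v -> dotv v z = 0 by rewrite -zf => -[].
have z0 : z 0 0 = 0.
  have /FP : F_minf (vec3 (-1) 0 0 : 'rV[R]_3) by split; rewrite !vec3E.
  by rewrite dotv3 !vec3E; lra.
have z2 : z 0 2 = 0.
  have /FP : F_minf (vec3 0 0 1 : 'rV[R]_3) by split; rewrite !vec3E.
  by rewrite dotv3 !vec3E; lra.
have K1 : Kexp (vec3 0 1 1 : 'rV[R]_3).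
  by left; rewrite /= !vec3E mul0r expR0 mul1r.
exists (z 0 1); last by apply: vec3_ext; rewrite !vec3E.
have := zd _ K1; rewrite dotv3 !vec3E z0 z2 !mul0r mulr0 add0r addr0 mul1r.
rewrite le_eqVlt => /orP[/eqP z1|//].
have : F_minf (vec3 0 1 1 : 'rV[R]_3).
  by rewrite -zf; split=> //; rewrite /perp /= dotv3 !vec3E z0 z2 -z1; ring.
by case; rewrite !vec3E => _ _ /eqP; rewrite oner_eq0.
Qed.

Lemma perp_vec3 (R : realType) (b : R) (v : 'rV[R]_3) :
  0 < b -> perp (vec3 0 b 0) v <-> v 0 1 = 0.
Proof.
move=> b0; rewrite /perp /= dotv3 !vec3E !mulr0 add0r addr0.
split=> [/eqP|->]; last by rewrite mul0r.
by rewrite mulf_eq0 (gt_eqF b0) orbF => /eqP.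
Qed.

(** Reduces a lower bound on [gamma] to an inequality in the first two coordinates of a
    competitor. *)
Lemma le_gamma (R : realType) (g : R -> R) (b eta c : R) : 0 < b -> 0 <= c ->
  (forall x y, 0 < y -> 0 < x -> x <= eta -> y * expR (x / y) <= eta ->
    c * x <= g y) ->
  (c%:E <= gamma g (vec3 0 b 0) eta)%E.
Proof.
move=> b0 c0 cg; apply: le_ereal_inf_tmp => _ [v [w [u [[[[clv _] veta] nFv] wP uP wu ->]]]].
have Kv : Kexp v by move: clv; rewrite -(closure_id _).1//; exact: closed_Kexp.
have [v1 v2] : 0 < v 0 1 /\ v 0 1 * expR (v 0 0 / v 0 1) <= v 0 2 by case: Kv.
have v2_ge0 : 0 <= v 0 2 by case: (Kexp_ge0 Kv).
have coord_eta i : v 0 i <= eta.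
  exact: le_trans (ler_norm _) (le_trans (norm_coord_le _ _) veta).
have {wP} wE : w = vec3 (v 0 0) 0 (v 0 2).
  case: wP => /(perp_vec3 _ b0) w1 wmin.
  have /wmin : perp (vec3 0 b 0) (vec3 (v 0 0) 0 (v 0 2)) by apply/perp_vec3; rewrite ?vec3E.
  rewrite -ler_sqr ?nnegrE ?enorm_ge0// !enorm3_sqr !rV_subE !vec3E w1 => vw.
  have d0 : (v 0 0 - w 0 0) ^+ 2 <= 0 by have := sqr_ge0 (v 0 2 - w 0 2); lra.
  have d2 : (v 0 2 - w 0 2) ^+ 2 <= 0 by have := sqr_ge0 (v 0 0 - w 0 0); lra.
  apply: vec3_ext; rewrite !vec3E//; apply/eqP; rewrite eq_sym -subr_eq0 -sqrf_eq0.
    by rewrite eq_le d0 sqr_ge0.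
  by rewrite eq_le d2 sqr_ge0.
(* Otherwise [w] lies in the face and is its own projection, against [w <> u]. *)
have v0 : 0 < v 0 0.
  rewrite ltNge; apply/negP => v0; apply: wu.
  have Fw : F_minf w by rewrite wE; split; rewrite !vec3E.
  have [_ /(_ _ Fw)] := uP; rewrite subrr enorm0 => /enorm_le0/eqP.
  by rewrite subr_eq0 => /eqP.
have -> : enorm (w - v) = v 0 1.
  rewrite (_ : w - v = vec3 0 (- v 0 1) 0).
    by rewrite enorm_vec3_1 normrN gtr0_norm.
  by rewrite wE; apply: vec3_ext; rewrite !(rV_subE, vec3E); ring.
have wu_le : enorm (w - u) <= v 0 0.
  have /uP.2/le_trans : F_minf (vec3 0 0 (v 0 2)) by split; rewrite !vec3E.
  apply; rewrite (_ : w - _ = vec3 (v 0 0) 0 0).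
    by rewrite enorm_vec3_0 gtr0_norm.
  by rewrite wE; apply: vec3_ext; rewrite !(rV_subE, vec3E); ring.
have wu_gt0 : 0 < enorm (w - u).
  rewrite ltNge; apply/negP => /enorm_le0/eqP.
  by rewrite subr_eq0 => /eqP.
have cv := cg (v 0 0) (v 0 1) v1 v0 (coord_eta 0) (le_trans v2 (coord_eta 2)).
rewrite lee_fin ler_pdivlMr//.
exact: le_trans (ler_wpM2l c0 wu_le) cv.
Qed.

(** Since [v 0 0 > 0], clearing the second coordinate of [v] gives [w], and clearing the first of
    [w] gives [u]; this triple is admissible in the infimum. *)
Lemma gamma_le (R : realType) (g : R -> R) (b eta : R) (v : 'rV[R]_3) :
  0 < b -> boundary Kexp v -> enorm v <= eta -> 0 < v 0 0 ->
  (gamma g (vec3 0 b 0) eta <= (g (v 0 1) / v 0 0)%:E)%E.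
Proof.
move=> b0 bv veta v0.
have Kv : Kexp v by move: bv.1; rewrite -(closure_id _).1//; exact: closed_Kexp.
have [v1 v2] := Kexp_ge0 Kv.
have wv : vec3 (v 0 0) 0 (v 0 2) - v = vec3 0 (- v 0 1) 0.
  by apply: vec3_ext; rewrite !(rV_subE, vec3E); ring.
have wu : vec3 (v 0 0) 0 (v 0 2) - vec3 0 0 (v 0 2) = vec3 (v 0 0) 0 0.
  by apply: vec3_ext; rewrite !(rV_subE, vec3E); ring.
apply: ereal_inf_lbound; exists v, (vec3 (v 0 0) 0 (v 0 2)), (vec3 0 0 (v 0 2)); split.
- by split=> // -[]; rewrite leNgt v0.
- split=> [|q /(perp_vec3 _ b0) q1]; first by apply/perp_vec3; rewrite ?vec3E.
  apply: le_enorm3; rewrite !rV_subE !vec3E q1.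
  by have := sqr_ge0 (v 0 0 - q 0 0); have := sqr_ge0 (v 0 2 - q 0 2); lra.
- split=> [|q [q0 q2 q1]]; first by split; rewrite !vec3E.
  apply: le_enorm3; rewrite !rV_subE !vec3E q1.
  have : 0 <= (v 0 2 - q 0 2) ^+ 2 by exact: sqr_ge0.
  have : v 0 0 ^+ 2 <= (v 0 0 - q 0 0) ^+ 2 by rewrite ler_sqr ?nnegrE; lra.
  by lra.
- move=> /(congr1 (fun x : 'rV[R]_3 => x 0 0)); rewrite !vec3E => e.
  by rewrite e ltxx in v0.
- by rewrite wv wu enorm_vec3_0 enorm_vec3_1 normrN ger0_norm// gtr0_norm.
Qed.

(* [k] plays the role of kappa_{z, eta}. Take [p] nearest to [q] in [Kexp], [w] its
   projection to the hyperplane and [u] that of [w] to the face: either [w = u],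
   or [p] is a competitor in the infimum [gamma], so that
   [enorm (w - u) <= g (enorm (w - p)) / gamma]. *)
Lemma edist_face_le (R : realType) (g : R -> R) (b eta k : R) (q : 'rV[R]_3) :
  0 < b -> 0 <= k -> (forall s, 0 <= s -> 0 <= g s) ->
  (forall s t, 0 <= s -> s <= t -> g s <= g t) ->
  (forall s, 0 <= s -> s <= eta -> 2 * s <= k * g s) ->
  (forall r, (gamma g (vec3 0 b 0) eta <= r%:E)%E -> 2 <= k * r) ->
  q 0 1 = 0 -> enorm q <= eta ->
  Defs.edist q F_minf <= k * g (Defs.edist q Kexp).
Proof.
move=> b0 k0 g_ge0 g_mono k_lin k_gamma q1 qeta.
have K0 : Kexp (0 : 'rV[R]_3) by right; exact: F_minf0.
have d_ge0 : 0 <= Defs.edist q Kexp by apply: edist_set_ge0; exists 0.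
have [Fq|nFq] := pselect (F_minf q).
  apply: le_trans (edist_le _ Fq) _.
  by rewrite subrr enorm0 mulr_ge0// g_ge0.
have nKq : ~ Kexp q by move=> /Kexp_plane/(_ q1).
have [p pP] := ex_proj q (@closed_Kexp R) (ex_intro _ _ K0).
have peta : enorm p <= eta.
  exact: le_trans (enorm_cone_proj (@Kexp_scale R) pP) qeta.
have dE := edist_proj pP; set s := Defs.edist q Kexp in d_ge0 dE *.
have s_eta : s <= eta.
  by apply: le_trans (edist_le _ K0) _; rewrite subr0.
have [p1 p2] := Kexp_ge0 pP.1.
have qw : enorm (q - vec3 (p 0 0) 0 (p 0 2)) <= s.
  rewrite dE; apply: le_enorm3; rewrite !rV_subE !vec3E q1.
  by have := sqr_ge0 (p 0 1); lra.
have ks := k_lin _ d_ge0 s_eta.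
(* If [p 0 0 <= 0], then [w] is in the face and [s] alone bounds the distance. Otherwise the bound
   is [s + p 0 0], and each summand is at most half of [k * g s]: this is the source of the factors
   2 in kappa. *)
have [p0|p0] := leP (p 0 0) 0.
  have /(edist_le q) h : F_minf (vec3 (p 0 0) 0 (p 0 2)) by split; rewrite !vec3E.
  have := le_trans h qw; lra.
have /(edist_le q) h : F_minf (vec3 0 0 (p 0 2)) by split; rewrite !vec3E.
have tri := enorm_distD (vec3 (p 0 0) 0 (p 0 2)) q (vec3 0 0 (p 0 2)).
rewrite (_ : vec3 (p 0 0) _ _ - _ = vec3 (p 0 0) 0 0) in tri; last first.
  by apply: vec3_ext; rewrite !(rV_subE, vec3E); ring.
rewrite enorm_vec3_0 gtr0_norm// in tri.
have p1s : g (p 0 1) <= g s.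
  apply: g_mono => //; have := norm_coord_le (q - p) 1.
  by rewrite dE rV_subE q1 sub0r normrN ger0_norm.
have := k_gamma _ (gamma_le g b0 (proj_boundary pP nKq) peta p0).
rewrite mulrA ler_pdivlMr// => /le_trans/(_ (ler_wpM2l k0 p1s)); lra.
Qed.

(** * Residual functions from a gauge *)

Lemma one_step_frf_psi (R : realType) (g kap : R -> R) (b : R) :
  0 < b -> g 0 = 0 ->
  (forall s t, 0 <= s -> s <= t -> g s <= g t) ->
  (forall t, 0 <= t -> 0 <= kap t) ->
  (forall s t, 0 <= s -> s <= t -> kap s <= kap t) ->
  (forall s t, 0 <= s -> s <= t -> 2 * s <= kap t * g s) ->
  (forall r t, 0 <= t -> (gamma g (vec3 0 b 0) t <= r%:E)%E -> 2 <= kap t * r) ->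
  perp (vec3 0 b 0) `&` Kexp = F_minf ->
  one_step_frf Kexp (vec3 0 b 0) (psi_exp g kap (vec3 0 b 0)).
Proof.
move=> b0 g0 g_mono kap_ge0 kap_mono kap_lin kap_gamma face.
have g_ge0 s : 0 <= s -> 0 <= g s by move=> s0; rewrite -g0 g_mono.
have zE : enorm (vec3 0 b 0) = b by rewrite enorm_vec3_1 gtr0_norm.
rewrite /psi_exp; pose m (eps : R) := Num.max eps (eps / b).
have m_ge eps : eps <= m eps by rewrite le_max lexx.
have m_mono eps eps' : eps <= eps' -> m eps <= m eps'.
  move=> h; rewrite ge_max !le_max h /=; apply/orP; right.
  by rewrite ler_pM2r ?invr_gt0.
have m_ge0 eps : 0 <= eps -> 0 <= m eps by move=> e0; exact: le_trans (m_ge _).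
split=> [eps t e0 t0|eps eps' t e0 le t0|eps t t' e0 t0 tt'|t t0|x eps _ e0 xK xz];
  rewrite !zE -!/(m _).
- by rewrite addr_ge0 ?m_ge0// mulr_ge0 ?kap_ge0 ?g_ge0// addr_ge0 ?m_ge0.
- have mm := m_mono _ _ le; apply: lerD => //; apply: ler_wpM2l; first exact: kap_ge0.
  by apply: g_mono; [rewrite addr_ge0 ?m_ge0|exact: lerD].
- by rewrite lerD2l ler_wpM2r ?kap_mono// g_ge0// addr_ge0 ?m_ge0.
- by rewrite /m mul0r maxxx addr0 g0 mulr0 addr0.
rewrite setIC face.
have K0 : Kexp (0 : 'rV[R]_3) by right; exact: F_minf0.
pose q := vec3 (x 0 0) 0 (x 0 2).
have xq : x - q = vec3 0 (x 0 1) 0.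
  by apply: vec3_ext; rewrite !(rV_subE, vec3E); ring.
(* The lower bound comes from the distance to the cone, where the second coordinate is nonnegative;
   the upper one from [x 0 1 * b <= eps]. *)
have x1m : `|x 0 1| <= m eps.
  rewrite ler_norml; apply/andP; split.
    have [p pP] := ex_proj x (@closed_Kexp R) (ex_intro _ _ K0).
    have [p1 _] := Kexp_ge0 pP.1.
    have := norm_coord_le (x - p) 1; rewrite -(edist_proj pP) rV_subE ler_norml.
    by move=> /andP[h _]; have := m_ge eps; lra.
  rewrite le_max; apply/orP; right; rewrite ler_pdivlMr//.
  by move: xz; rewrite dotv3 !vec3E; lra.
have xq_le : enorm (x - q) <= m eps by rewrite xq enorm_vec3_1.
have qx : enorm q <= enorm x.
  by apply: le_enorm3; rewrite !vec3E; have := sqr_ge0 (x 0 1); lra.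
have F0 : (@F_minf R) !=set0 by exists 0; exact: F_minf0.
apply: le_trans (edist_triangle x q F0) _; apply: lerD => //.
apply: le_trans (edist_face_le b0 (kap_ge0 _ (enorm_ge0 x)) g_ge0 g_mono _ _ _ qx) _.
- by move=> s s0 sx; exact: kap_lin.
- by move=> r; apply: kap_gamma; exact: enorm_ge0.
- by rewrite vec3E.
- apply: ler_wpM2l; first exact/kap_ge0/enorm_ge0.
  apply: g_mono; first by apply: edist_set_ge0; exists 0.
  apply: le_trans (edist_triangle q x (ex_intro _ _ K0)) _.
  by rewrite [leLHS]addrC (enormB q) lerD.
Qed.

(** The distance estimate passes to any majorant of [psi]; the other clauses follow from the form of
    the majorant. *)
Lemma one_step_frf_le (R : realType) n (K : set 'rV[R]_n) z (psi : R -> R -> R)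
    (g rho : R -> R) (c : R) :
  one_step_frf K z psi -> 0 <= c -> g 0 = 0 ->
  (forall s t, 0 <= s -> s <= t -> g s <= g t) ->
  (forall t, 0 <= t -> 0 <= rho t) ->
  (forall s t, 0 <= s -> s <= t -> rho s <= rho t) ->
  (forall eps t, 0 <= eps -> 0 <= t -> psi eps t <= c * eps + rho t * g eps) ->
  one_step_frf K z (fun eps t => c * eps + rho t * g eps).
Proof.
move=> [_ _ _ _ psiK] c0 g0 g_mono rho_ge0 rho_mono psi_le.
have g_ge0 s : 0 <= s -> 0 <= g s by move=> s0; rewrite -g0 g_mono.
split=> [eps t e0 t0|eps eps' t e0 le t0|eps t t' e0 t0 tt'|t t0|x eps xK e0 dx xz].
- by rewrite addr_ge0// mulr_ge0 ?rho_ge0 ?g_ge0.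
- by rewrite lerD// ler_wpM2l ?rho_ge0 ?g_mono.
- by rewrite lerD2l ler_wpM2r ?g_ge0 ?rho_mono.
- by rewrite g0 !mulr0 addr0.
- exact: le_trans (psiK _ _ xK e0 dx xz) (psi_le _ _ e0 (enorm_ge0 _)).
Qed.

(* What the argument uses of [g], together with the finite part [bf] of [kappa]. *)
Record residual_gauge (R : realType) (g bf : R -> R) : Prop := ResidualGauge {
  gauge0 : g 0 = 0;
  gauge_mono : forall s t, 0 <= s -> s <= t -> g s <= g t;
  gauge_factor_mono : forall s t, 0 <= s -> s <= t -> bf s <= bf t;
  gauge_factor_ge0 : forall t, 0 <= t -> 0 <= bf t;
  gauge_lin : forall s t, 0 <= s -> s <= t -> 2 * s <= bf t * g s;
  gauge_scale : forall L, 1 <= L ->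
    exists2 C, 0 <= C & forall t, 0 <= t -> g (L * t) <= C * g t;
  gauge_expR : forall eta, exists2 C, 0 < C &
    forall x y, 0 < y -> 0 < x -> x <= eta -> y * expR (x / y) <= eta ->
      x <= C * g y }.

(** * The power gauge *)

Lemma residual_gauge_powR (R : realType) (alpha : R) : 0 < alpha < 1 ->
  residual_gauge (fun t : R => `|t| `^ alpha) (fun t => 2 * t `^ (1 - alpha)).
Proof.
move=> /andP[a0 a1]; have a0' := ltW a0.
have b0 : 0 < 1 - alpha by rewrite subr_gt0.
have b0' := ltW b0.
have split_powR s : 0 < s -> s = s `^ (1 - alpha) * s `^ alpha.
  by move=> s0; rewrite -powRD ?subrK ?powRr1 ?(ltW s0)// (gt_eqF s0) implybT.
split=> [|s t s0 st|s t s0 st|t t0|s t s0 st|L L1|eta].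
- by rewrite normr0 powR0// gt_eqF.
- have t0 := le_trans s0 st.
  by apply: ge0_ler_powR; rewrite ?nnegrE// !ger0_norm.
- rewrite ler_pM2l//; apply: ge0_ler_powR; rewrite ?nnegrE//.
  exact: le_trans st.
- by rewrite mulr_ge0// powR_ge0.
- have [->|sn0] := eqVneq s 0; first by rewrite mulr0 mulr_ge0 ?mulr_ge0 ?powR_ge0.
  have s_gt0 : 0 < s by rewrite lt_def sn0.
  rewrite -mulrA ler_pM2l// ger0_norm// [leLHS]split_powR//.
  by rewrite ler_wpM2r ?powR_ge0//; apply: ge0_ler_powR; rewrite ?nnegrE// (le_trans s0).
- have L0 : 0 <= L by exact: le_trans L1.
  exists (L `^ alpha) => [|t t0]; first exact: powR_ge0.
  by rewrite normrM (ger0_norm L0) powRM.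
- exists (eta `^ (1 - alpha) / (1 - alpha) + 1).
    by rewrite ltr_wpDl// divr_ge0// powR_ge0.
  move=> x y y0 x0 _ le_eta; rewrite (gtr0_norm y0).
  (* Raising [y * expR u <= eta] to the power [1 - alpha] and bounding the exponential below by its
     argument controls [u * y]^ (1 - alpha)[; multiplying by]y [^ alpha] recovers [x]. *)
  set u := x / y in le_eta; have u0 : 0 < u by exact: divr_gt0.
  have : (y * expR u) `^ (1 - alpha) <= eta `^ (1 - alpha).
    apply: ge0_ler_powR; rewrite ?nnegrE//; last apply: le_trans le_eta.
      by rewrite mulr_ge0 ?expR_ge0// ltW.
    by rewrite mulr_ge0 ?expR_ge0// ltW.
  rewrite powRM ?expR_ge0 ?(ltW y0)// -expRM => le_eta'.
  have ule : u * (1 - alpha) <= expR (u * (1 - alpha)).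
    by have := expR_ge1Dx (u * (1 - alpha)); lra.
  have yb0 := powR_ge0 y (1 - alpha); have ya0 := powR_ge0 y alpha.
  have key : u * y `^ (1 - alpha) <= eta `^ (1 - alpha) / (1 - alpha).
    rewrite ler_pdivlMr//; apply: le_trans le_eta'.
    by rewrite mulrAC mulrC; exact: ler_wpM2l.
  have -> : x = u * y `^ (1 - alpha) * y `^ alpha.
    by rewrite -mulrA -split_powR// divfK// gt_eqF.
  by have := ler_wpM2r ya0 key; lra.
Qed.

(** * The entropic gauge *)

Lemma ln_increment_le (R : realType) (s t : R) :
  0 < s -> 0 < t -> s * (ln t - ln s) <= t - s.
Proof.
move=> s0 t0; rewrite -ln_div ?posrE//.
have := @le_ln1Dx R (t / s - 1); rewrite [1 + _]addrC subrK => le.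
have : ln (t / s) <= t / s - 1 by apply: le; have := divr_gt0 t0 s0; lra.
by move=> /(ler_wpM2l (ltW s0)); rewrite mulrBr mulr1 mulrCA divff ?gt_eqF// mulr1.
Qed.

Lemma g_minf_small (R : realType) (t : R) :
  0 < t -> t <= (expR 1 ^+ 2)^-1 -> g_minf t = - t * ln t.
Proof. by move=> t0 ta; rewrite /g_minf leNgt t0 ta. Qed.

Lemma g_minf_large (R : realType) (t : R) :
  (expR 1 ^+ 2)^-1 < t -> g_minf t = t + (expR 1 ^+ 2)^-1.
Proof.
move=> ta; rewrite /g_minf !leNgt ta /=.
by rewrite (lt_trans _ ta)// invr_gt0 exprn_gt0 ?expR_gt0.
Qed.

Lemma ln_expR1_sqrV (R : realType) : ln (expR 1 ^+ 2)^-1 = - 2 :> R.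
Proof. by rewrite lnV ?posrE ?exprn_gt0 ?expR_gt0// lnXn ?expR_gt0// expRK. Qed.

Lemma ln_small (R : realType) (t : R) :
  0 < t -> t <= (expR 1 ^+ 2)^-1 -> ln t <= - 2.
Proof.
by move=> t0 ta; rewrite -ln_expR1_sqrV ler_ln// posrE invr_gt0 exprn_gt0// expR_gt0.
Qed.

Lemma le_g_minf (R : realType) (t : R) : 0 <= t -> t <= g_minf t.
Proof.
rewrite le_eqVlt => /predU1P[<-|t0]; first by rewrite /g_minf lexx.
have [ta|ta] := leP t (expR 1 ^+ 2)^-1.
  by rewrite g_minf_small//; have := ler_wpM2l (ltW t0) (ln_small t0 ta); lra.
by rewrite g_minf_large// lerDl invr_ge0 exprn_ge0// expR_ge0.
Qed.

(** On the logarithmic branch the increment from [s] to [r] is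
    [- (r - s) * ln r - s * (ln r - ln s)], at least [2 * (r - s) - (r - s)]. At the breakpoint [a]
    the value jumps up: [g_minf a = 2 * a], while beyond it the value is [t + a]. *)
Lemma g_minf_mono (R : realType) (s t : R) : 0 <= s -> s <= t -> g_minf s <= g_minf t.
Proof.
rewrite le_eqVlt => /predU1P[<- t0|s0].
  by rewrite {1}/g_minf lexx (le_trans t0)// le_g_minf.
set a : R := (expR 1 ^+ 2)^-1.
have a0 : 0 < a by rewrite invr_gt0 exprn_gt0// expR_gt0.
have small r : s <= r -> r <= a -> g_minf s <= g_minf r.
  move=> sr ra; have r0 := lt_le_trans s0 sr.
  rewrite !g_minf_small// ?(le_trans sr)//.
  have := ln_increment_le s0 r0.
  have : (r - s) * ln r <= (r - s) * - 2 by rewrite ler_wpM2l ?subr_ge0 ?ln_small.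
  lra.
move=> st; have [ta|ta] := leP t a; first exact: small.
rewrite (g_minf_large ta) -/a; have [sa|sa] := leP s a.
  apply: le_trans (small a sa (lexx a)) _; rewrite g_minf_small//.
  by have := ln_expR1_sqrV R; rewrite -/a => ->; lra.
by rewrite (g_minf_large sa) lerD2r.
Qed.

Lemma residual_gauge_g_minf (R : realType) : residual_gauge (@g_minf R) (fun=> 2).
Proof.
set a : R := (expR 1 ^+ 2)^-1.
have a0 : 0 < a by rewrite invr_gt0 exprn_gt0// expR_gt0.
have g00 : g_minf (0 : R) = 0 by rewrite /g_minf lexx.
split=> // [|s t s0 st|L L1|eta].
- exact: g_minf_mono.
- by rewrite ler_pM2l// le_g_minf.
- have L0 : 0 <= L by exact: le_trans L1.
  (* If [L * t <= a], monotonicity of [ln] gives even the factor [L]; if [L * t > a], then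
     [L * t + a < 2 * (L * t)]. *)
  exists (2 * L) => [|t]; first exact: mulr_ge0.
  rewrite le_eqVlt => /predU1P[<-|t0]; first by rewrite mulr0 g00 mulr0.
  have tL : t <= L * t by rewrite ler_peMl// ltW.
  have tg := le_g_minf (ltW t0).
  have Lg : L * t <= L * g_minf t by exact: ler_wpM2l.
  have Lg0 : 0 <= L * g_minf t by rewrite mulr_ge0// (le_trans _ tg)// ltW.
  have [Lta|Lta] := leP (L * t) a.
    have ta := le_trans tL Lta; have Lt0 := lt_le_trans t0 tL.
    have : ln t <= ln (L * t) by rewrite ler_ln.
    move=> /(ler_wpM2l (ltW Lt0)).
    by move: Lg0; rewrite !g_minf_small// => *; lra.
  rewrite (g_minf_large Lta) -/a; lra.
- exists (`|ln eta| + 1 + `|eta| / a).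
    by have := normr_ge0 (ln eta); have := divr_ge0 (normr_ge0 eta) (ltW a0); lra.
  move=> x y y0 x0 x_eta le_eta.
  have y_g := le_g_minf (ltW y0).
  have lny := ler_norm (ln eta); have eta_n := ler_norm eta.
  have t1 : `|ln eta| * y <= `|ln eta| * g_minf y by rewrite ler_wpM2l.
  have t2 : `|eta| / a * y <= `|eta| / a * g_minf y.
    by rewrite ler_wpM2l// divr_ge0// ltW.
  have t3 : 0 <= `|ln eta| * y by rewrite mulr_ge0// ltW.
  have t4 : 0 <= `|eta| / a * y by rewrite mulr_ge0 ?divr_ge0 ?(ltW a0) ?(ltW y0).
  have [ya|ya] := leP y a.
    have eta0 : 0 < eta by apply: lt_le_trans le_eta; rewrite mulr_gt0// expR_gt0.
    have : ln y + x / y <= ln eta.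
      by rewrite -[x / y]expRK -lnM ?posrE ?expR_gt0// ler_ln ?posrE ?mulr_gt0 ?expR_gt0.
    rewrite -(ler_pM2r y0) mulrDl divfK ?gt_eqF// => h.
    have : ln eta * y <= `|ln eta| * y by rewrite ler_wpM2r// ltW.
    by move: h t1 t2; rewrite g_minf_small//; lra.
  have : `|eta| <= `|eta| / a * y by rewrite -mulrA ler_peMr// mulrC ler_pdivlMr ?mul1r ?ltW.
  have := le_trans x_eta eta_n; lra.
Qed.

(** * Finiteness and monotonicity of kappa, and the conclusion *)

Lemma fin_inve (R : realType) (G : \bar R) (c : R) : 0 < c -> (c%:E <= G)%E ->
  exists h : R, [/\ 0 <= h, (G^-1)%E = h%:E &
    forall r, (G <= r%:E)%E -> 1 <= h * r].
Proof.
move=> c0; case: G => [r||].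
  rewrite lee_fin => cr; have r0 := lt_le_trans c0 cr.
  exists r^-1; split=> [||s]; first by rewrite invr_ge0 ltW.
    by rewrite inver gt_eqF.
  by rewrite lee_fin => rs; rewrite mulrC ler_pdivlMr// mul1r.
  (* An infinite [G] has inverse 0 and lies below no real, so the last clause is vacuous. *)
  by move=> _; exists 0; split=> // r; rewrite leye_eq.
by rewrite leeNy_eq.
Qed.

Lemma gamma_anti (R : realType) (g : R -> R) z (s t : R) :
  s <= t -> (gamma g z t <= gamma g z s)%E.
Proof.
move=> st; apply: ereal_inf_le_tmp => _ [v [w [u [[[bv vs] nF] wP uP wu ->]]]].
by exists v, w, u; split=> //; split=> //; split=> //; exact: le_trans st.
Qed.

Lemma residual_gauge_frf (R : realType) (z : 'rV[R]_3) (g bf : R -> R)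
    (kappa : R -> \bar R) :
  dual_cone Kexp z -> perp z `&` Kexp = F_minf -> residual_gauge g bf ->
  (forall t, kappa t = maxe (bf t)%:E (2%:E * (gamma g z t)^-1)%E) ->
  [/\ forall t, 0 <= t -> kappa t \is a fin_num,
      one_step_frf Kexp z (psi_exp g (fun t => fine (kappa t)) z)
    & exists (c : R) (rho : R -> R),
      [/\ 0 < c,
          forall t, 0 <= t -> 0 <= rho t,
          forall s t, 0 <= s -> s <= t -> rho s <= rho t
        & one_step_frf Kexp z (fun eps t => c * eps + rho t * g eps)]].
Proof.
move=> zd zf [g0 g_mono bf_mono bf_ge0 g_lin g_scale g_exp] kappaE.
have [b b0 zb] := face_normal zd zf; subst z.
have g_ge0 s : 0 <= s -> 0 <= g s by move=> s0; rewrite -g0 g_mono.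
have gamma_pos t : exists2 c : R, 0 < c & (c%:E <= gamma g (vec3 0 b 0) t)%E.
  have [C C0 hC] := g_exp t; exists C^-1; first by rewrite invr_gt0.
  apply: le_gamma => // [|x y y0 x0 xt yt]; first by rewrite invr_ge0 ltW.
  by rewrite mulrC ler_pdivrMr// mulrC; exact: hC.
have inv t := let: ex_intro2 c c0 ct := gamma_pos t in fin_inve c0 ct.
have kap_fin t : kappa t \is a fin_num.
  by have [h [_ hE _]] := inv t; rewrite kappaE hE -EFinM -EFin_max.
have kapK t : (fine (kappa t))%:E = kappa t by rewrite fineK.
have bf_kap t : bf t <= fine (kappa t).
  by rewrite -lee_fin kapK kappaE le_max lexx.
have kap_mono s t : 0 <= s -> s <= t -> fine (kappa s) <= fine (kappa t).
  move=> s0 st; rewrite -lee_fin !kapK !kappaE ge_max !le_max lee_fin bf_mono//=.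
  have [cs cs0 cse] := gamma_pos s; have [ct ct0 cte] := gamma_pos t.
  (* A larger ball admits more competitors, so [gamma] decreases, and inversion reverses the
     order. *)
  rewrite lee_pmul2l// lee_pV2 ?gamma_anti ?orbT// inE.
    by rewrite (le_trans _ cse)// lee_fin ltW.
  by rewrite (le_trans _ cte)// lee_fin ltW.
have kap_ge0 t : 0 <= t -> 0 <= fine (kappa t).
  by move=> t0; exact: le_trans (bf_ge0 _ t0) (bf_kap t).
have kap_lin s t : 0 <= s -> s <= t -> 2 * s <= fine (kappa t) * g s.
  move=> s0 st; apply: le_trans (g_lin _ _ s0 st) _.
  by rewrite ler_wpM2r ?g_ge0.
have kap_gamma r t : 0 <= t -> (gamma g (vec3 0 b 0) t <= r%:E)%E ->
    2 <= fine (kappa t) * r.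
  move=> t0 gr; have [h [h0 hE /(_ _ gr) hr]] := inv t.
  have r0 : 0 < r.
    have [c c0 ce] := gamma_pos t; apply: lt_le_trans c0 _.
    by rewrite -lee_fin (le_trans ce).
  have : 2 * h <= fine (kappa t).
    by rewrite -lee_fin kapK kappaE le_max hE -EFinM lexx orbT.
  by move=> /(ler_wpM2r (ltW r0)); lra.
have psi_frf : one_step_frf Kexp (vec3 0 b 0)
    (psi_exp g (fun t => fine (kappa t)) (vec3 0 b 0)).
  exact: one_step_frf_psi.
split=> [t _||]; [exact: kap_fin|exact: psi_frf|].
(* Chosen so that the maximum in [psi_exp] is [M * eps] and the argument of [g] is [(1 + M) * eps];
   the constant [C] of [g_scale] for [1 + M] then goes into [rho]. *)
pose M := Num.max 1 b^-1.
have M1 : 1 <= M by rewrite le_max lexx.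
have M0 : 0 < M by exact: lt_le_trans M1.
have [|C C0 gC] := g_scale (1 + M); first by rewrite lerDl ltW.
exists M, (fun t => fine (kappa t) * C); split=> // [t t0|s t s0 st|].
- by rewrite mulr_ge0 ?kap_ge0.
- by rewrite ler_wpM2r ?kap_mono.
apply: one_step_frf_le psi_frf _ g0 g_mono _ _ _ => [|t t0|s t s0 st|eps t e0 t0].
- exact: ltW.
- by rewrite mulr_ge0 ?kap_ge0.
- by rewrite ler_wpM2r ?kap_mono.
rewrite /psi_exp enorm_vec3_1 (gtr0_norm b0).
have -> : Num.max eps (eps / b) = M * eps.
  by rewrite /M [RHS]mulrC maxr_pMr// mulr1.
rewrite lerD2l -mulrA ler_wpM2l ?kap_ge0//.
by rewrite -[eps in eps + _]mul1r -mulrDl gC.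
Qed.

Unset Implicit Arguments.

(* The inverse in the extended reals satisfies 0^-1 = +oo and +oo^-1 = 0. The
   first conclusion says that kappa is finite, so that [fine] only forgets it. *)
Theorem corollary4p4 (R : realType) (z : 'rV[R]_3)
    (g : R -> R) (kappa : R -> \bar R)
    (z_dual : dual_cone Kexp z)
    (z_face : perp z `&` Kexp = F_minf)
    (g_kappa :
      (g = g_minf /\
       kappa = fun t => maxe 2%:E (2%:E * (gamma g z t)^-1)%E) \/
      (exists2 alpha : R, 0 < alpha < 1 &
       g = (fun t => `|t| `^ alpha) /\
       kappa = fun t =>
         maxe (2 * t `^ (1 - alpha))%:E (2%:E * (gamma g z t)^-1)%E)) :
  [/\ forall t, 0 <= t -> kappa t \is a fin_num,
      one_step_frf Kexp z (psi_exp g (fun t => fine (kappa t)) z)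
    & exists (c : R) (rho : R -> R),
      [/\ 0 < c,
          forall t, 0 <= t -> 0 <= rho t,
          forall s t, 0 <= s -> s <= t -> rho s <= rho t
        & one_step_frf Kexp z (fun eps t => c * eps + rho t * g eps)]].
Proof.
case: g_kappa => [[gE kE]|[alpha a01 [gE kE]]]; subst g kappa.
  exact: residual_gauge_frf z_dual z_face (residual_gauge_g_minf R) _.
exact: residual_gauge_frf z_dual z_face (residual_gauge_powR a01) _.
Qed.
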